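(* Let $a,b\in\mathbb{Z}$ with $a<b$, let $V:\llbracket a,b\rrbracket\to\mathbb{R}$ be convex, and let $k$ be an integer. If the degree of freedom of $e^{-V}$ is $k+1$, then there exist $k$ affine functions $\psi_1,\psi_2,\dots,\psi_k$ on $\llbracket a,b\rrbracket$ such that $V(z)=\max_{1\le i\le k}\psi_i(z)$ for all $z\in\llbracket a,b\rrbracket$.
   Context: For integers $a\le b$, $\llbracket a,b\rrbracket$ denotes the set of integers $z$ with $a\le z\le b$. A function $V:\llbracket a,b\rrbracket\to\mathbb{R}$ is convex if $V(z-1)-2V(z)+V(z+1)\ge 0$ for every integer $z$ with $a<z<b$ (equivalently, its extension by $+\infty$ to $\mathbb{Z}$ is convex); it is concave if $-V$ is convex, and affine if it is both convex and concave, i.e. of the form $z\mapsto mz+n$ with $m,n\in\mathbb{R}$. A function $f:\llbracket a,b\rrbracket\to[0,\infty)$ is log-concave on $\llbracket a,b\rrbracket$ if $\log f$ is concave; for positive $f$ this means $f(z)^2\ge f(z-1)f(z+1)$ for all integers $a<z<b$. Degree of freedom (discrete): for $V$ convex on $\llbracket a,b\rrbracket$ with real values, the degree of freedom of $e^{-V}$ is the largest integer $k$ such that there exist $\alpha>0$ and linearly independent functions $W_1,\dots,W_k:\llbracket a,b\rrbracket\to\mathbb{R}$ such that for all $\epsilon_1,\dots,\epsilon_k\in[-\alpha,\alpha]$ the function $e^{-V}\bigl(1+\sum_{i=1}^k\epsilon_iW_i\bigr)$ is log-concave on $\llbracket a,b\rrbracket$. *)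

(* Defs.v *)
From HB Require Import structures.
From mathcomp Require Import all_boot all_order all_algebra.
From mathcomp Require Import all_classical all_reals all_analysis.
Set Implicit Arguments.
Unset Strict Implicit.
Unset Printing Implicit Defensive.
Import Order.TTheory GRing.Theory Num.Theory.
Import numFieldNormedType.Exports.
Local Open Scope ring_scope.

(* A function on the set of integers z with a <= z <= b is encoded as a
   function on all of int; every notion below only reads its values at
   integers of `[a, b], so the values elsewhere are irrelevant. *)

Definition zconvex (R : realType) (a b : int) (V : int -> R) : Prop :=
  forall z : int, z \in `]a, b[ -> 0 <= V (z - 1) - 2 * V z + V (z + 1).

Definition zconcave (R : realType) (a b : int) (V : int -> R) : Prop :=
  zconvex a b (fun z => - V z).

Definition zaffine (R : realType) (a b : int) (V : int -> R) : Prop :=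
  zconvex a b V /\ zconcave a b V.

(* Concavity for functions that may take the value -oo: g, extended by -oo
   outside `[a, b], is concave on the integers.  It is stated with three
   arbitrary points because the second-difference inequality at z - 1, z, z + 1
   does not see gaps of length at least 2 in the support, and so is too weak
   for such functions. *)
Definition zconcave_ereal (R : realType) (a b : int) (g : int -> \bar R)
    : Prop :=
  forall x y z : int, a <= x -> x < y -> y < z -> z <= b ->
  ((z - y)%:~R%:E * g x + (y - x)%:~R%:E * g z <= (z - x)%:~R%:E * g y)%E.

(* [lne 0 = -oo], so f is allowed to vanish. *)
Definition log_concave (R : realType) (a b : int) (f : int -> R) : Prop :=
  (forall z : int, z \in `[a, b] -> 0 <= f z) /\
  zconcave_ereal a b (fun z => lne (f z)%:E).

Definition lin_indep (R : realType) (a b : int) (k : nat)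
    (W : 'I_k -> int -> R) : Prop :=
  forall c : 'I_k -> R,
    (forall z : int, z \in `[a, b] -> \sum_(i < k) c i * W i z = 0) ->
    forall i : 'I_k, c i = 0.

Definition has_freedom (R : realType) (a b : int) (V : int -> R) (k : nat)
    : Prop :=
  exists (alpha : R) (W : 'I_k -> int -> R),
    [/\ 0 < alpha,
        lin_indep a b W
      & forall eps : 'I_k -> R,
          (forall i : 'I_k, eps i \in `[- alpha, alpha]) ->
          log_concave a b
            (fun z => expR (- V z) * (1 + \sum_(i < k) eps i * W i z))].

(* The degree of freedom of e^{-V} on `[a, b] is k. *)
Definition is_degree_of_freedom (R : realType) (a b : int) (V : int -> R)
    (k : nat) : Prop :=
  has_freedom a b V k /\ forall j : nat, has_freedom a b V j -> (j <= k)%N.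

(* Main.v *)
(* If V has m kinks (interior points with positive second difference), then V
   is the maximum of its tangents at a and at the kinks, that is, of m + 1
   affine functions.  On the other hand e^{-V} can be perturbed independently
   along 1, along z, and along one ramp max (0, z - c) for each kink c, so its
   degree of freedom k + 1 is at least m + 2, whence m + 1 <= k. *)
Require Import Defs.
From HB Require Import structures.
From mathcomp Require Import all_boot all_order all_algebra.
From mathcomp Require Import all_classical all_reals all_analysis.
From mathcomp Require Import ring lra zify.
Set Implicit Arguments.
Unset Strict Implicit.
Unset Printing Implicit Defensive.
Import Order.TTheory GRing.Theory Num.Theory.
Import numFieldNormedType.Exports.
Local Open Scope ring_scope.

Definition diff2 (R : realType) (V : int -> R) (z : int) : R :=
  V (z - 1) - 2 * V z + V (z + 1).

(** The slope is the forward difference, so the line also meets [V] at [c + 1]. *)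
Definition tangent (R : realType) (V : int -> R) (c z : int) : R :=
  V c + (V (c + 1) - V c) * (z - c)%:~R.

Definition ramp (R : realType) (c z : int) : R := Num.max 0 (z - c)%:~R.

Definition kinks (R : realType) (a b : int) (V : int -> R) : seq int :=
  [seq z <- [seq a + n%:Z | n <- iota 1 `|b - a|.-1] | 0 < diff2 V z].

Lemma mem_kinks (R : realType) (a b : int) (V : int -> R) (z : int) :
  a < b -> (z \in kinks a b V) = (a < z < b) && (0 < diff2 V z).
Proof.
move=> ab; rewrite mem_filter andbC; congr (_ && _).
apply/mapP/idP => [[n]|zab].
  by rewrite mem_iota => ? ->; lia.
by exists `|z - a|%N; [rewrite mem_iota; lia | lia].
Qed.

Lemma kinks_uniq (R : realType) (a b : int) (V : int -> R) :
  uniq (kinks a b V).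
Proof.
by apply: filter_uniq; rewrite map_inj_uniq ?iota_uniq// => m n; lia.
Qed.

(** * Supporting lines and log-concavity *)

Lemma tangent_affine (R : realType) (a b : int) (V : int -> R) (c : int) :
  zaffine a b (tangent V c).
Proof.
by split=> z _; rewrite /tangent !(intrD, intrB, intrN); lra.
Qed.

(** Increments of a convex function are nondecreasing, so those from [c] on are at least the slope
    of the tangent, and those before [c] at most that slope. Each induction carries the bound on the
    increment along with the bound on the value. *)
Lemma tangent_le (R : realType) (a b : int) (V : int -> R) (c z : int) :
  zconvex a b V -> a <= c -> c < b -> a <= z -> z <= b -> tangent V c z <= V z.
Proof.
move=> cV ac cb az zb; pose s := V (c + 1) - V c.
have right n : c + n%:Z + 1 <= b ->
    V c + s * n%:R <= V (c + n%:Z) /\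
    s <= V (c + n%:Z + 1) - V (c + n%:Z).
  elim: n => [|n IH] h; first by rewrite addr0; split; rewrite /s; lra.
  have [|h1 h2] := IH; first lia.
  have := cV (c + n%:Z + 1); rewrite in_itv /= => /(_ ltac:(lia)).
  rewrite addrK -natr1 (_ : c + n.+1%:Z = c + n%:Z + 1); last lia.
  by move=> h3; split; lra.
have left n : a <= c - n%:Z ->
    V c - s * n%:R <= V (c - n%:Z) /\
    V (c - n%:Z + 1) - V (c - n%:Z) <= s.
  elim: n => [|n IH] h; first by rewrite subr0; split; rewrite /s; lra.
  have [|h1 h2] := IH; first lia.
  have := cV (c - n%:Z); rewrite in_itv /= => /(_ ltac:(lia)).
  rewrite -natr1 (_ : c - n.+1%:Z = c - n%:Z - 1); last lia.
  by rewrite subrK => h3; split; lra.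
rewrite /tangent -/s.
have [zc|[->|cz]] : z < c \/ z = c \/ c < z by lia.
- have [n zE] : exists n : nat, z = c - n%:Z by exists `|z - c|%N; lia.
  have [|h _] := left n; first lia.
  rewrite zE (_ : c - n%:Z - c = - n%:Z); last lia.
  by rewrite intrN; lra.
- by rewrite subrr; lra.
(* [right n] requires [c + n + 1 <= b]; to reach [z = b], take [n = z - c - 1] and add its two
   conclusions. *)
- have [n zE] : exists n : nat, z = c + n%:Z + 1 by exists `|z - c|.-1%N; lia.
  have [|h1 h2] := right n; first lia.
  rewrite zE (_ : c + n%:Z + 1 - c = n%:Z + 1); last lia.
  by rewrite intrD; lra.
Qed.

Lemma zconvex_three_points (R : realType) (a b : int) (V : int -> R)
    (x y z : int) :
  zconvex a b V -> a <= x -> x < y -> y < z -> z <= b ->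
  (z - x)%:~R * V y <= (z - y)%:~R * V x + (y - x)%:~R * V z.
Proof.
move=> cV ax xy yz zb.
(* The tangent at [y] is affine with value [V y] at [y], so its bounds at [x] and [z], weighted by
   [z - y] and [y - x], add up to the claim. *)
have hx : tangent V y x <= V x by apply: tangent_le cV _ _ _ _; lia.
have hz : tangent V y z <= V z by apply: tangent_le cV _ _ _ _; lia.
have p1 : 0 <= (z - y)%:~R :> R by rewrite ler0z; lia.
have p2 : 0 <= (y - x)%:~R :> R by rewrite ler0z; lia.
have := ler_wpM2l p1 hx; have := ler_wpM2l p2 hz.
rewrite /tangent !(intrD, intrN); set X := x%:~R; set Y := y%:~R.
set Z := z%:~R; nra.
Qed.

(** Positivity of [g] keeps [lne] finite on the interval, so the extended three-point condition
    becomes a real inequality, supplied by [zconvex_three_points]. *)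
Lemma log_concave_expR_mul (R : realType) (a b : int) (V g : int -> R) :
  (forall z, z \in `[a, b] -> 0 < g z) ->
  zconvex a b (fun z => V z - ln (g z)) ->
  log_concave a b (fun z => expR (- V z) * g z).
Proof.
move=> g0 cU; split=> [z zab|x y z ax xy yz zb].
  by rewrite mulr_ge0 ?expR_ge0// ltW ?g0.
have lnf t : a <= t <= b ->
    lne (expR (- V t) * g t)%:E = (- (V t - ln (g t)))%:E.
  move=> tab; have gt : 0 < g t by apply: g0; rewrite in_itv.
  rewrite lne_EFin; last by rewrite mulr_gt0 ?expR_gt0.
  by rewrite lnM ?posrE ?expR_gt0// expRK opprB addrC.
rewrite !lnf; [|lia..].
rewrite -!EFinM -EFinD lee_fin.
have := zconvex_three_points cU ax xy yz zb; lra.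
Qed.

(** * Ramps and their independence *)

Lemma diff2_ramp (R : realType) (c z : int) :
  diff2 (ramp R c) z = (c == z)%:R.
Proof.
rewrite /diff2 /ramp; case: eqVneq => [<-|cz].
  have -> : c - 1 - c = - 1 by lia.
  have -> : c + 1 - c = 1 by lia.
  by rewrite subrr maxxx max_l ?max_r ?ler01 ?lerz0// mulr0 subr0 add0r.
have [h|h] : c <= z - 1 \/ z + 1 <= c by lia.
  rewrite !max_r ?ler0z; [|lia..].
  by rewrite !(intrD, intrN) mulr0n; lra.
by rewrite !max_l ?lerz0; [rewrite mulr0n; lra|lia..].
Qed.

Lemma diff2_sum_ramp (R : realType) (k : nat) (p : 'I_k -> int)
    (c : 'I_k -> R) (z : int) :
  diff2 (fun t => \sum_(i < k) c i * ramp R (p i) t) z =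
  \sum_(i < k) c i * (p i == z)%:R.
Proof.
rewrite /diff2 mulr_sumr -sumrB -big_split/=; apply: eq_bigr => i _.
rewrite -diff2_ramp /diff2; ring.
Qed.

(* Every ramp vanishes on [a - 2, a - 1], so a combination vanishing on
   [a, b] vanishes on [a - 2, b], where its second difference at p i is c i. *)
Lemma ramps_lin_indep (R : realType) (a b : int) (k : nat) (p : 'I_k -> int) :
  injective p -> (forall i, a - 1 <= p i < b) ->
  lin_indep a b (fun i => ramp R (p i)).
Proof.
move=> pinj pab c c0 j.
pose F t := \sum_(i < k) c i * ramp R (p i) t.
have F0 t : a - 2 <= t <= b -> F t = 0.
  move=> tab; have [ta|ta] := leP a t.
    by apply: c0; rewrite in_itv /=; lia.
  rewrite /F big1// => i _; rewrite /ramp max_l ?mulr0// lerz0.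
  by have := pab i; lia.
have pj := pab j.
have := diff2_sum_ramp p c (p j); rewrite -/F {1}/diff2 !F0; [|lia..].
rewrite (bigD1 j)//= eqxx big1 => [|i ij]; first by rewrite mulr1 addr0; lra.
by rewrite (inj_eq pinj) (negbTE ij) mulr0.
Qed.

(** * Lower bound for the degree of freedom *)

Lemma ln1D_bounds (R : realType) (t e : R) :
  `|t| <= e -> e <= 2^-1 -> - (2 * e) <= ln (1 + t) <= e.
Proof.
rewrite ler_norml => /andP[te et] e2; have t1 : 0 < 1 + t by lra.
apply/andP; split; last by apply: le_trans et; apply: le_ln1Dx; lra.
(* The lower bound is [ln (1 + u) <= u] at [1 + u = (1 + t)^-1]; the factor 2 comes from
   [2^-1 <= 1 + t]. *)
have bound : - t / (1 + t) <= 2 * e by rewrite ler_pdivrMr//; nra.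
have invE : (1 + t)^-1 = 1 + - t / (1 + t) by field; lra.
rewrite -[leRHS]opprK lerN2 -lnV ?posrE// invE.
apply: le_trans bound; apply: le_ln1Dx.
by rewrite -subr_gt0 opprK addrC -invE invr_gt0.
Qed.

(** The AM-GM inequality in logarithmic form. *)
Lemma ln_midpoint (R : realType) (x y : R) :
  0 < x -> 0 < y -> ln x + ln y <= 2 * ln ((x + y) / 2).
Proof.
move=> x0 y0; have m0 : 0 < (x + y) / 2 by lra.
rewrite mulr_natl mulr2n -!lnM ?posrE// ler_ln ?posrE ?mulr_gt0 ?addr_gt0//.
by have := sqr_ge0 (x - y); rewrite expr2; nra.
Qed.

Lemma seq_pos_lower_bound (R : realType) (T : eqType) (s : seq T)
    (f : T -> R) :
  {in s, forall x, 0 < f x} -> exists2 d, 0 < d & {in s, forall x, d <= f x}.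
Proof.
elim: s => [|y s IH] f0; first by exists 1.
have [x xs|d d0 dP] := IH; first by apply: f0; rewrite inE xs orbT.
exists (Num.min (f y) d); first by rewrite lt_min d0 f0 ?mem_head.
move=> x; rewrite inE ge_min => /orP[/eqP->|/dP->]; last by rewrite orbT.
by rewrite lexx.
Qed.

(* Away from the kinks the perturbing factor is locally affine, and -ln of a
   positive affine function is convex; at a kink the strict convexity of V
   absorbs the perturbation. *)
Lemma zconvex_sub_ln (R : realType) (a b : int) (V h : int -> R) (e : R) :
  zconvex a b V -> e <= 2^-1 ->
  (forall z : int, z \in `[a, b] -> `|h z| <= e) ->
  (forall z : int, z \in `]a, b[ -> 6 * e <= diff2 V z \/ diff2 h z = 0) ->
  zconvex a b (fun z => V z - ln (1 + h z)).
Proof.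
move=> cV e2 he hd z zab; have := zab; rewrite in_itv /= => zab'.
have inab (t : int) : z - 1 <= t <= z + 1 -> t \in `[a, b]
  by rewrite in_itv /= => tz; lia.
have h1 := he (z - 1) (inab (z - 1) ltac:(lia)).
have h2 := he z (inab z ltac:(lia)).
have h3 := he (z + 1) (inab (z + 1) ltac:(lia)).
have [dV|dh] := hd z zab.
  (* Origin of the 6: the second difference of [ln (1 + h)] is at most [e + 2 * (2 * e) + e]. *)
  have /andP[_ l1] := ln1D_bounds h1 e2.
  have /andP[l2 _] := ln1D_bounds h2 e2.
  have /andP[_ l3] := ln1D_bounds h3 e2.
  by move: dV; rewrite /diff2; lra.
move: h1 h2 h3; rewrite !ler_norml => /andP[h1 _] /andP[h2 _] /andP[h3 _].
have := cV z zab.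
have p1 : 0 < 1 + h (z - 1) by lra.
have p3 : 0 < 1 + h (z + 1) by lra.
have := ln_midpoint p1 p3.
move: dh; rewrite /diff2 => dh.
rewrite (_ : (_ + _) / 2 = 1 + h z); last by lra.
by lra.
Qed.

Lemma ramp_bounds (R : realType) (a b c z : int) :
  a <= c + 1 -> a <= z <= b -> 0 <= ramp R c z <= (b - a + 1)%:~R.
Proof.
move=> ac zab; rewrite /ramp le_max lexx /= ge_max ler0z ler_int; lia.
Qed.

(* The perturbations are the ramps at a - 1, at a (together spanning the
   affine functions) and at each kink. *)
Lemma kinks_freedom (R : realType) (a b : int) (V : int -> R) :
  a < b -> zconvex a b V -> has_freedom a b V (size (kinks a b V)).+2.
Proof.
move=> ab cV; set ks := kinks a b V; set n := (size ks).+2.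
pose s := [:: a - 1, a & ks]; pose p (i : 'I_n) := nth 0 s i.
have us : uniq s.
  rewrite /= !inE !negb_or !mem_kinks// kinks_uniq andbT; lia.
have ps i : p i \in s by apply: mem_nth; apply: ltn_ord.
have pab i : a - 1 <= p i < b.
  by have := ps i; rewrite !inE mem_kinks//; lia.
have pinj : injective p.
  by move=> i j /eqP; rewrite nth_uniq ?ltn_ord// => /eqP/val_inj.
have [d d0 dP] : exists2 d, 0 < d & {in ks, forall z, d <= diff2 V z}.
  by apply: seq_pos_lower_bound => z; rewrite mem_kinks// => /andP[].
(* [2^-1] serves the logarithm estimates, and [d / 6] lets every kink absorb the perturbation. [L]
   bounds all the ramps on the interval; the one at [a - 1] attains it at [b]. *)
pose e : R := Num.min 2^-1 (d / 6); pose L : R := (b - a + 1)%:~R.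
have e0 : 0 < e by rewrite lt_min; apply/andP; split; lra.
have e2 : e <= 2^-1 by rewrite ge_min lexx.
have ed : 6 * e <= d by have : e <= d / 6; [rewrite ge_min lexx orbT|lra].
have L0 : 0 < L by rewrite ltr0z; lia.
have nL0 : 0 < n%:R * L by rewrite mulr_gt0.
exists (e / (n%:R * L)), (fun i => ramp R (p i)); split.
- exact: divr_gt0.
- exact: ramps_lin_indep.
move=> eps epsP; set h := fun z => \sum_(i < n) eps i * ramp R (p i) z.
have he (z : int) : z \in `[a, b] -> `|h z| <= e.
  rewrite in_itv /= => zab; apply: (le_trans (ler_norm_sum _ _ _)).
  have -> : e = \sum_(i < n) (e / (n%:R * L) * L).
    rewrite sumr_const card_ord -[RHS]mulr_natr -mulrA (mulrC L).
    by rewrite divfK ?gt_eqF.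
  apply: ler_sum => i _; rewrite normrM; apply: ler_pM => //.
    by have := epsP i; rewrite in_itv /= ler_norml.
  have /andP[r0 rL] : 0 <= ramp R (p i) z <= L.
    by apply: ramp_bounds => //; have := pab i; lia.
  by rewrite ger0_norm.
apply: log_concave_expR_mul => [z zab|].
  by have := he z zab; rewrite ler_norml => /andP[]; rewrite -/(h z); lra.
apply: (zconvex_sub_ln cV e2 he) => z; rewrite in_itv /= => zab.
have [zs|zs] := boolP (z \in ks); first by left; apply: le_trans (dP z zs).
right; rewrite diff2_sum_ramp big1// => i _.
rewrite (_ : (p i == z) = false) ?mulr0//; apply: contraNF zs => /eqP piz.
by have := ps i; rewrite piz !inE; case/or3P => // /eqP; lia.
Qed.

(* The tangent at the last kink before z (or at a) touches V at z and z + 1. *)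
Lemma tangent_touches (R : realType) (a b : int) (V : int -> R) (n : nat) :
  zconvex a b V -> a + n%:Z < b ->
  exists2 c, c \in a :: kinks a b V &
    tangent V c (a + n%:Z) = V (a + n%:Z) /\
    tangent V c (a + n%:Z + 1) = V (a + n%:Z + 1).
Proof.
move=> cV; elim: n => [|n IH] nb.
  exists a; first exact: mem_head.
  rewrite addr0 /tangent subrr mulr0 addr0 (_ : a + 1 - a = 1)//; last lia.
  by split; ring.
have [|c cs [t1 t2]] := IH; first lia.
rewrite (_ : a + n.+1%:Z = a + n%:Z + 1); last lia.
set z := a + n%:Z + 1 in t2 *.
have [zk|zk] := boolP (z \in kinks a b V).
  exists z; first by rewrite inE zk orbT.
  by rewrite /tangent subrr (_ : z + 1 - z = 1); last lia; split; ring.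
(* At a point that is not a kink, [V] and the tangent both have zero second difference; agreeing at
   [z - 1] and [z], they agree at [z + 1]. *)
exists c => //; split=> //.
have zab : z \in `]a, b[ by rewrite in_itv /= /z; lia.
have dV : diff2 V z = 0.
  apply/eqP; rewrite eq_le cV// andbT leNgt; apply: contra zk.
  by rewrite mem_kinks; [|lia]; move: zab; rewrite in_itv /= => -> ->.
have [_] := tangent_affine a b V c; have [/(_ z zab)] := tangent_affine a b V c.
move=> + _ /(_ z zab); move: dV; rewrite /diff2 t2.
rewrite (_ : z - 1 = a + n%:Z) ?t1; last by rewrite /z; lia.
lra.
Qed.

Theorem theorem1p3 (R : realType) (a b : int) (hab : a < b) (V : int -> R)
    (hV : zconvex a b V) (k : nat)
    (hk : is_degree_of_freedom a b V k.+1) :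
  exists psi : 'I_k -> int -> R,
    (forall i : 'I_k, zaffine a b (psi i)) /\
    (forall z : int, z \in `[a, b] ->
       (V z)%:E = \big[maxe/-oo%E]_(i < k) (psi i z)%:E).
Proof.
have sk : (size (a :: kinks a b V) <= k)%N.
  (* Maximality gives [(size (kinks a b V)).+2 <= k.+1], which is the bound by computation. *)
  by have [_ /(_ _ (kinks_freedom hab hV))] := hk.
(* Indices past the end of the list default to [a] and merely repeat the tangent there. *)
pose p (i : 'I_k) := nth a (a :: kinks a b V) i.
have pab i : a <= p i < b.
  have : p i \in a :: kinks a b V.
    have [?|?] := ltnP i (size (a :: kinks a b V)); first exact: mem_nth.
    by rewrite /p nth_default// mem_head.
  by rewrite inE mem_kinks//; lia.
exists (fun i => tangent V (p i)); split=> [i|z]; first exact: tangent_affine.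
rewrite in_itv /= => /andP[az zb].
have [i iz] : exists i, tangent V (p i) z = V z.
  have [c cs cz] : exists2 c, c \in a :: kinks a b V & tangent V c z = V z.
    have [zb'|zb'] : z < b \/ z = b by lia.
      have zE : z = a + `|z - a|%N%:Z by lia.
      have [|c cs [cz _]] := @tangent_touches R a b V `|z - a|%N hV; first lia.
      by exists c => //; rewrite zE.
    (* No tangent is based at [b]; the one touching [V] at [b - 1] also touches it at [b]. *)
    have zE : z = a + `|z - a|.-1%:Z + 1 by lia.
    have [|c cs [_ cz]] := @tangent_touches R a b V `|z - a|.-1 hV; first lia.
    by exists c => //; rewrite zE.
  have ck : (index c (a :: kinks a b V) < k)%N.
    by apply: leq_trans sk; rewrite index_mem.
  by exists (Ordinal ck); rewrite /p nth_index.
apply/eqP; rewrite eq_le; apply/andP; split.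
  by rewrite -iz; apply: (le_bigmax_cond _ (fun i => (tangent V (p i) z)%:E)).
apply/bigmax_leP; split=> [|j _]; first exact: leNye.
by have /andP[pj1 pj2] := pab j; rewrite lee_fin; apply: (tangent_le hV).
Qed.
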